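(* Suppose that there exist two positive functions $f,g:(0,1)\to(0,\infty)$ and a sequence of positive real numbers $\{a(n), n\in\mathbb{N}^*\}$ such that for every $n\in\mathbb{N}^*$, every nontrivial monotone symmetric subset $A\subset\{0,1\}^n$ and every $p\in(0,1)$, $$\frac{d\mu_p(A)}{dp}\geq\frac{a(n)}{g(p)}\,f(\mu_p(A)),$$ with $$\frac{f(x)}{x}\xrightarrow[x\to 0]{}1\quad\text{and}\quad\frac{g(p)}{p\log(1/p)}\xrightarrow[p\to 0]{}1.$$ Then $$\limsup_{n\to+\infty}\frac{a(n)}{\log n}\leq 1.$$
   Context: Here $\log$ is the natural logarithm and $\mathbb{N}^*$ is the set of positive integers. For $p\in[0,1]$, $\mu_p=\mu_{n,p}$ denotes the product Bernoulli probability measure on $\{0,1\}^n$: $\mu_{n,p}(x) = p^{\sum_{i=1}^n x_i}(1-p)^{\sum_{i=1}^n (1-x_i)}$. A subset $A\subset\{0,1\}^n$ is monotone if ($x\in A$ and $x\preceq y$) implies $y\in A$, where $\preceq$ is the coordinatewise partial order. $A$ is nontrivial if $A\neq\emptyset$ and $A\neq\{0,1\}^n$. $A$ is symmetric if there exists a subgroup $G$ of the symmetric group $\mathcal{S}_n$ acting transitively on $\{1,\ldots,n\}$ such that for all $g\in G$ and $x\in A$, $g\cdot x=(x_{g^{-1}(1)},\ldots,x_{g^{-1}(n)})\in A$. *)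

(* Defs.v *)
From mathcomp Require Import all_boot all_order all_algebra all_fingroup.
From mathcomp Require Import all_classical all_reals all_analysis.

Set Implicit Arguments.
Unset Strict Implicit.
Unset Printing Implicit Defensive.

Import Order.TTheory GRing.Theory Num.Theory.
Import numFieldNormedType.Exports.

Local Open Scope ring_scope.

Notation cube n := {ffun 'I_n -> bool}.

(* The exponents are sums in nat, with booleans read as 0 or 1. *)
Definition bernoulli_weight (R : realType) (n : nat) (p : R) (x : cube n) : R :=
  p ^+ (\sum_(i < n) x i)%N * (1 - p) ^+ (\sum_(i < n) (1 - x i))%N.

Definition bernoulli_measure (R : realType) (n : nat) (p : R)
    (A : {set cube n}) : R :=
  \sum_(x in A) bernoulli_weight p x.

Definition cube_le (n : nat) (x y : cube n) : Prop :=
  forall i : 'I_n, (x i <= y i)%N.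

Definition monotone_subset (n : nat) (A : {set cube n}) : Prop :=
  forall x y : cube n, x \in A -> cube_le x y -> y \in A.

Definition nontrivial_subset (n : nat) (A : {set cube n}) : Prop :=
  A <> finset.set0 /\ A <> [set: cube n]%SET.

Definition permute_coords (n : nat) (g : 'S_n) (x : cube n) : cube n :=
  [ffun i => x (g^-1%g i)].

Definition symmetric_subset (n : nat) (A : {set cube n}) : Prop :=
  exists G : {group 'S_n},
    [transitive G, on [set: 'I_n]%SET | 'P] /\
    forall (g : 'S_n) (x : cube n), g \in G -> x \in A ->
      permute_coords g x \in A.

(* Main.v *)
Require Import Defs.
From mathcomp Require Import all_boot all_order all_algebra all_fingroup.
From mathcomp Require Import all_classical all_reals all_analysis.
From mathcomp Require Import ring lra.

Set Implicit Arguments.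
Unset Strict Implicit.
Unset Printing Implicit Defensive.

Import Order.TTheory GRing.Theory Num.Theory.
Import numFieldNormedType.Exports.

Local Open Scope classical_set_scope.
Local Open Scope ring_scope.

(** The test family is the simplest possible one: the complement [nonzero_points n]
of the origin, that is, the event that some coordinate equals 1. Its measure is
[mu_p = 1 - (1 - p)^n], whose derivative is [n (1 - p)^(n-1)]; factoring
[1 - (1 - p)^n] as [p] times a geometric sum of [n] terms, each at least
[(1 - p)^(n-1)] and at most 1, gives [p mu_p' <= mu_p <= n p]
([onem_expr_bounds]).

The assumed differential inequality for this set then reads
[a n / g p * f mu_p <= mu_p' <= mu_p / p], i.e.
[a n <= log (1/p) * (g p / (p log (1/p))) / (f mu_p / mu_p)].
Both ratios tend to 1 as soon as [p] and [mu_p] tend to 0, and [p] should be as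
large as this permits. With [p = n^-(1 + c)] for a fixed [c > 0], one has
[mu_p <= n p = n^-c -> 0] while [log (1/p) = (1 + c) log n], so the limsup of
[a n / log n] is at most [1 + c]; finally [c] is arbitrary. *)

Lemma bernoulli_weight_prod (R : realType) (n : nat) (p : R) (x : cube n) :
  bernoulli_weight p x = \prod_(i < n) (if x i then p else 1 - p).
Proof.
rewrite /bernoulli_weight !expr_sum -big_split /=; apply: eq_bigr => i _.
by case: (x i); rewrite ?subnn ?subn0 !expr1 !expr0 ?mulr1 ?mul1r.
Qed.

Lemma bernoulli_measure_setT (R : realType) (n : nat) (p : R) :
  bernoulli_measure p [set: cube n]%SET = 1.
Proof.
rewrite /bernoulli_measure.
under eq_bigl do rewrite finset.in_setT.
under eq_bigr do rewrite bernoulli_weight_prod.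
rewrite -(bigA_distr_bigA (fun (_ : 'I_n) (b : bool) => if b then p else 1 - p)).
rewrite big1 // => i _.
by rewrite big_bool /= addrC subrK.
Qed.

Definition nonzero_points (n : nat) : {set cube n} := [set~ [ffun=> false]]%SET.

(** By complement: the origin has weight [(1 - p)^n] and the total mass is 1. *)
Lemma bernoulli_measure_nonzero (R : realType) (n : nat) (p : R) :
  bernoulli_measure p (nonzero_points n) = 1 - (1 - p) ^+ n.
Proof.
have := bernoulli_measure_setT n p.
rewrite /bernoulli_measure (bigD1 [ffun=> false]) ?finset.in_setT //=.
have w0 : bernoulli_weight p ([ffun=> false] : cube n) = (1 - p) ^+ n.
  rewrite bernoulli_weight_prod (eq_bigr (fun=> 1 - p)) ?prodr_const ?card_ord //.
  by move=> i _; rewrite ffunE.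
rewrite w0 => /(canRL (addKr _)); rewrite addrC => <-.
by apply: eq_bigl => x; rewrite !inE.
Qed.

Lemma derive_bernoulli_measure_nonzero (R : realType) (n : nat) (p : R) :
  derive1 (fun q : R => bernoulli_measure q (nonzero_points n)) p
    = n%:R * (1 - p) ^+ n.-1.
Proof.
under eq_fun do rewrite bernoulli_measure_nonzero.
rewrite derive1E.
have -> : (fun q : R => 1 - (1 - q) ^+ n) = cst 1 - (cst 1 - id) ^+ n.
  by apply/funext => q; rewrite !fctE.
by rewrite derive_val sub0r sub0r scalerN opprK /GRing.scale /= mulr1.
Qed.

Lemma nontrivial_nonzero_points (n : nat) :
  (0 < n)%N -> nontrivial_subset (nonzero_points n).
Proof.
move=> n0; split=> /finset.setP.
  move=> /(_ [ffun=> true]); rewrite !inE => /negbFE/eqP/ffunP.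
  by move=> /(_ (Ordinal n0)); rewrite !ffunE.
by move=> /(_ [ffun=> false]); rewrite !inE eqxx.
Qed.

Lemma monotone_nonzero_points (n : nat) : monotone_subset (nonzero_points n).
Proof.
move=> x y; rewrite !inE => x0 xy; apply: contra_neq x0 => y0.
apply/ffunP => i; have := xy i.
by rewrite y0 !ffunE; case: (x i).
Qed.

(** The whole symmetric group fixes the origin. The hypothesis excludes
[n = 0], where the empty set of coordinates is not an orbit. *)
Lemma symmetric_nonzero_points (n : nat) :
  (0 < n)%N -> symmetric_subset (nonzero_points n).
Proof.
move=> n0; exists [group of [set: 'S_n]%SET]; split.
  apply/finset.imsetP; exists (Ordinal n0); rewrite ?finset.in_setT //.
  apply/finset.setP => i; rewrite finset.in_setT; apply/esym/orbitP.
  by exists (tperm (Ordinal n0) i); rewrite ?finset.in_setT //= /aperm tpermL.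
move=> g x _; rewrite !inE; apply: contra_neq => gx0.
apply/ffunP => i; move/ffunP: gx0 => /(_ (g i)).
by rewrite !ffunE permK.
Qed.

Lemma cvg_to_at_right (T : Type) (F : set_system T) (FF : Filter F)
    (R : realType) (u : T -> R) (x : R) :
  (\forall t \near F, x < u t) -> u t @[t --> F] --> x ->
  u t @[t --> F] --> x^'+.
Proof.
move=> xu ux P Px; have := ux _ Px.
by apply: filterS2 xu => t xut /(_ xut).
Qed.

Lemma limn_esup_le_near (R : realType) (u : nat -> \bar R) (l : \bar R) :
  (\forall n \near \oo, (u n <= l)%E) -> (limn_esup u <= l)%E.
Proof.
move=> ul; rewrite /limn_esup /limf_esup.
apply: (@le_trans _ _ (ereal_sup [set u n | n in [set n | (u n <= l)%E]])).
  by apply: ereal_inf_lbound; exists [set n | (u n <= l)%E].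
by apply: ub_ereal_sup => _ [n /= un <-].
Qed.

(** [1 - (1 - p)^n] is [p] times the sum of [(1 - p)^i] for [i < n]; the terms of
this sum decrease from 1 to [(1 - p)^(n-1)]. The lower bound is [p] times the
derivative of [1 - (1 - p)^n]. *)
Lemma onem_expr_bounds (R : realType) (n : nat) (p : R) :
  0 <= p <= 1 ->
  p * (n%:R * (1 - p) ^+ n.-1) <= 1 - (1 - p) ^+ n <= p * n%:R.
Proof.
move=> /andP[p0 p1].
have -> : 1 - (1 - p) ^+ n = p * \sum_(i < n) (1 - p) ^+ i.
  by rewrite -[LHS]opprB subrX1; ring.
have q01 : 0 <= 1 - p <= 1 by lra.
have sumc (c : R) : n%:R * c = \sum_(i < n) c.
  by rewrite sumr_const card_ord mulr_natl.
apply/andP; split; apply: ler_wpM2l => //; last rewrite -[n%:R]mulr1.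
all: rewrite sumc.
  apply: ler_sum => -[i /= ilt] _; apply: ler_wiXn2l; [lra | lra |].
  by rewrite -ltnS (ltn_predK ilt).
by apply: ler_sum => i _; apply: exprn_ile1; lra.
Qed.

Lemma cvgn_inv_at_right (R : realType) :
  (n%:R^-1 : R) @[n --> \oo] --> (0 : R)^'+.
Proof.
have n0 : \forall n \near \oo, 0 < n%:R :> R.
  by near=> n; rewrite ltr0n; near: n; exists 1%N.
apply: cvg_to_at_right.
  by apply: filterS n0 => n; rewrite invr_gt0.
by apply/gtr0_cvgV0 => //; exact: cvgr_idn.
Unshelve. all: by end_near. Qed.

Theorem lemma5p1 (R : realType) (f g : R -> R) (a : nat -> R)
    (f_pos : forall x : R, 0 < x < 1 -> 0 < f x)
    (g_pos : forall p : R, 0 < p < 1 -> 0 < g p)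
    (a_pos : forall n : nat, (0 < n)%N -> 0 < a n)
    (sharp : forall (n : nat) (A : {set cube n}) (p : R), (0 < n)%N ->
       nontrivial_subset A -> monotone_subset A -> symmetric_subset A ->
       0 < p < 1 ->
       a n / g p * f (bernoulli_measure p A)
         <= derive1 (fun q : R => bernoulli_measure q A) p)
    (f_lim : f x / x @[x --> (0 : R)^'+] --> (1 : R))
    (g_lim : g p / (p * ln (1 / p)) @[p --> (0 : R)^'+] --> (1 : R)) :
  (limn_esup (fun n : nat => (a n / ln n%:R)%:E) <= 1)%E.
Proof.
apply/lee_addgt0Pr => e e0.
(* c < e leaves room to pass from a limit 1 + c to an eventual bound 1 + e. *)
have [c [c0 ce]] : exists c : R, 0 < c /\ 1 + c < 1 + e.
  by exists (e / 2); lra.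
pose p (n : nat) : R := n%:R^-1 `^ (1 + c).
pose mu (n : nat) : R := bernoulli_measure (p n) (nonzero_points n).
have n_gt1 : \forall n \near \oo, (1 < n)%N by exists 2%N.
have p01 n : (1 < n)%N -> 0 < p n < 1.
  move=> n1; have n0 : 0 < n%:R :> R by rewrite ltr0n (ltn_trans _ n1).
  have one_pow : 1 = 1 `^ (1 + c) :> R by rewrite powR1.
  rewrite powR_gt0 ?invr_gt0 //= [ltRHS]one_pow.
  rewrite gt0_ltr_powR ?nnegrE ?invr_ge0 ?invf_lt1 ?ltr1n //; lra.
have np n : (1 < n)%N -> p n * n%:R = n%:R^-1 `^ c.
  move=> n1; have n0 : 0 < n%:R :> R by rewrite ltr0n (ltn_trans _ n1).
  rewrite /p powRD; last by rewrite invr_eq0 (gt_eqF n0) implybT.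
  by rewrite powRr1 ?invr_ge0 ?ler0n // mulrAC mulVf ?mul1r // gt_eqF.
have ln_p n : (1 < n)%N -> ln (1 / p n) = (1 + c) * ln n%:R.
  move=> n1; have n0 : 0 < n%:R :> R by rewrite ltr0n (ltn_trans _ n1).
  have /andP[pn0 _] := p01 _ n1.
  by rewrite div1r lnV ?posrE // ln_powR lnV ?posrE // mulrN opprK.
(* The lower bound is p times the derivative of the measure at p; the upper
   bound is n^-c by np, which forces mu n to 0. *)
have mu_bounds n : (1 < n)%N ->
    p n * (n%:R * (1 - p n) ^+ n.-1) <= mu n <= p n * n%:R.
  move=> n1; rewrite /mu bernoulli_measure_nonzero.
  by apply: onem_expr_bounds; have /andP[/ltW -> /ltW ->] := p01 _ n1.
have mu01 n : (1 < n)%N -> 0 < mu n < 1.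
  move=> n1; have n0 : (0 < n)%N by exact: ltn_trans n1.
  have /andP[pn0 pn1] := p01 _ n1.
  rewrite /mu bernoulli_measure_nonzero subr_gt0 gtrBl exprn_gt0 ?subr_gt0 //.
  by rewrite andbT exprn_ilt1 -?lt0n ?subr_ge0 ?ltW ?gtrBl.
have p_lim : p n @[n --> \oo] --> (0 : R)^'+.
  apply: cvg_to_at_right.
    by apply: filterS n_gt1 => n /p01/andP[].
  apply: (cvg_comp _ _ (@cvgn_inv_at_right R) (powR_cvg0 _)).
  by rewrite addr_gt0.
have mu_lim : mu n @[n --> \oo] --> (0 : R)^'+.
  apply: cvg_to_at_right.
    by apply: filterS n_gt1 => n /mu01/andP[].
  apply: (@squeeze_cvgr _ _ _ _ (cst 0) (fun n => n%:R^-1 `^ c)); last 2 first.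
  - exact: cvg_cst.
  - exact: (cvg_comp _ _ (@cvgn_inv_at_right R) (powR_cvg0 c0)).
  apply: filterS n_gt1 => n n1; rewrite -np //.
  by have /andP[/ltW -> _] := mu01 _ n1; have /andP[_ ->] := mu_bounds _ n1.
pose F x : R := f x / x.
pose G q : R := g q / (q * ln (1 / q)).
have bound_lim : (1 + c) * (G (p n) / F (mu n)) @[n --> \oo]
    --> (1 + c) * (1 / 1).
  apply: cvgMr; apply: cvgM; first exact: cvg_comp p_lim g_lim.
  by apply: cvgV; [exact: oner_neq0 | exact: cvg_comp mu_lim f_lim].
rewrite divr1 mulr1 in bound_lim.
apply: limn_esup_le_near.
near=> n; rewrite -EFinD lee_fin.
have n1 : (1 < n)%N by near: n.
apply: (@le_trans _ _ ((1 + c) * (G (p n) / F (mu n)))); last first.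
  by near: n; exact: cvgr_le bound_lim _ ce.
have n0 : (0 < n)%N by exact: ltn_trans n1.
have /andP[pn0 pn1] := p01 _ n1; have /andP[mu0 mu1] := mu01 _ n1.
have gp : 0 < g (p n) by apply: g_pos; rewrite pn0.
have fmu : 0 < f (mu n) by apply: f_pos; rewrite mu0.
have ln0 : 0 < ln n%:R :> R by rewrite ln_gt0 ?ltr1n.
have := sharp n (nonzero_points n) (p n) n0 (nontrivial_nonzero_points n0)
  (@monotone_nonzero_points n) (symmetric_nonzero_points n0) (p01 _ n1).
rewrite derive_bernoulli_measure_nonzero -/(mu n) => dmu.
(* Multiplying the differential inequality by p absorbs the derivative into
   the measure itself. *)
have key : p n * (a n / g (p n) * f (mu n)) <= mu n.
  have /andP[+ _] := mu_bounds _ n1; apply: le_trans.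
  by rewrite ler_pM2l.
rewrite /F /G ln_p //.
rewrite ler_pdivrMr //.
have -> : (1 + c) * (g (p n) / (p n * ((1 + c) * ln n%:R)) / (f (mu n) / mu n))
    * ln n%:R = mu n * (g (p n) / (p n * f (mu n))).
  by field; rewrite !gt_eqF //; lra.
rewrite -ler_pdivrMr ?divr_gt0 ?mulr_gt0 //.
apply: le_trans key; rewrite le_eqVlt; apply/orP; left; apply/eqP.
by field; rewrite !gt_eqF.
Unshelve. all: by end_near. Qed.
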